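(* Let $d$ and $n_1,\dots,n_d$ be positive integers, $n=n_1+\dots+n_d$, and let $\Omega\subseteq [n_1]\times\dots\times[n_d]$ be an observation mask. Then $\Omega$ satisfies unique recovery if and only if the matrix $V_\Omega^{\mathbb{F}_2}\in\mathbb{F}_2^{|\Omega|\times n}$ has rank $n-d+1$ over $\mathbb{F}_2$.
   Context: Notation: $[m]=\{1,\dots,m\}$, and $\mathbb{F}_2$ is the field with two elements. A real tensor $T\in\mathbb{R}^{n_1\times\dots\times n_d}$ has rank one if it is nonzero and there are vectors $u^{(k)}\in\mathbb{R}^{n_k}$ with $T_{i_1,\dots,i_d}=\prod_{k=1}^d u^{(k)}_{i_k}$ for all $(i_1,\dots,i_d)$. Exact completion problem for $(\Omega,\hat T)$, $\hat T\in\mathbb{R}^\Omega$: find a rank-one tensor $T\in\mathbb{R}^{n_1\times\dots\times n_d}$ with $T_\alpha=\hat T_\alpha$ for all $\alpha\in\Omega$. The mask $\Omega$ satisfies unique recovery if for every $\hat T\in\mathbb{R}^\Omega$ with all entries nonzero the exact completion problem is either infeasible or has a unique solution $T$. For $\alpha=(j_1,\dots,j_d)\in[n_1]\times\dots\times[n_d]$ let $v_\alpha\in\mathbb{F}_2^n$ be the concatenation of the indicator vectors $e^{(n_1)}_{j_1}\in\mathbb{F}_2^{n_1},\dots,e^{(n_d)}_{j_d}\in\mathbb{F}_2^{n_d}$ (where $e^{(m)}_j$ has a $1$ in position $j$ and $0$ elsewhere). The matrix $V_\Omega^{\mathbb{F}_2}$ has rows $v_\alpha^T$, $\alpha\in\Omega$.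 *)

(* Defs.v *)
From mathcomp Require Import all_boot all_order all_algebra.
From mathcomp Require Import reals.

Set Implicit Arguments.
Unset Strict Implicit.
Unset Printing Implicit Defensive.

Import GRing.Theory.
Local Open Scope ring_scope.

Definition multi_index (d : nat) (n : 'I_d -> nat) : finType :=
  {dffun forall k : 'I_d, 'I_(n k)}.

Definition tensor (R : realType) (d : nat) (n : 'I_d -> nat) : Type :=
  {ffun multi_index n -> R}.

Definition rank_one (R : realType) (d : nat) (n : 'I_d -> nat)
    (T : tensor R n) : Prop :=
  T <> 0 /\
  exists u : forall k : 'I_d, 'rV[R]_(n k),
    forall i : multi_index n, T i = \prod_(k < d) u k 0 (i k).

Definition exact_completion (R : realType) (d : nat) (n : 'I_d -> nat)
    (Omega : {set multi_index n}) (That : {ffun {a | a \in Omega} -> R})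
    (T : tensor R n) : Prop :=
  rank_one T /\ forall a : {a | a \in Omega}, T (val a) = That a.

Definition unique_recovery (R : realType) (d : nat) (n : 'I_d -> nat)
    (Omega : {set multi_index n}) : Prop :=
  forall That : {ffun {a | a \in Omega} -> R},
    (forall a, That a <> 0) ->
    ~ (exists T : tensor R n, exact_completion That T) \/
    (exists! T : tensor R n, exact_completion That T).

Definition index_vector (d : nat) (n : 'I_d -> nat) (a : multi_index n) :
    'rV['F_2]_(\sum_(k < d) n k) :=
  \mxrow_(k < d) delta_mx 0 (a k).

Definition mask_matrix (d : nat) (n : 'I_d -> nat) (Omega : {set multi_index n}) :
    'M['F_2]_(#|Omega|, \sum_(k < d) n k) :=
  \matrix_(r < #|Omega|) index_vector (enum_val r).

(* Main.v *)
Require Import Defs.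
From mathcomp Require Import all_boot all_order all_algebra.
From mathcomp Require Import reals boolp exp.

Set Implicit Arguments.
Unset Strict Implicit.
Unset Printing Implicit Defensive.

Import Order.TTheory GRing.Theory Num.Theory.
Local Open Scope ring_scope.

(** Call a mask additively rigid over a field [F] when a sum
    [\sum_k X k (a k)] that vanishes at every observed multi-index [a]
    vanishes at every multi-index.  The theorem is obtained by showing that
    both sides are equivalent to additive rigidity over the two-element field.

    For the rank: a sum [\sum_k X k (a k)] is the product of the row [v_a] with
    the column made of the [X k], so rigidity says that the rows of observed
    indices span the rows of all indices.  Over every field the latter span a
    space of dimension [N - d + 1], where [N] is the sum of the [n k]
    ([rank_index_mxT]): adding the [d] unit rows
    that sit at one base point [g], one per block, gives the whole space, and
    the overlap is the line of [v_g].  Hence [rank_index_mxP].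

    From unique recovery to rigidity ([unique_recovery_rigid]): a family [X]
    over the two-element field gives the rank-one tensor of signs
    [(-1) ^ \sum_k X k (a k)]; if its exponent is zero on the mask, it agrees
    there with the constant tensor 1, and uniqueness makes the two equal.

    From rigidity to unique recovery ([rigid_unique_recovery]): rigidity forces
    every coordinate to be met by the mask, so the factors of any completion
    have only nonzero entries, and the entrywise ratio of two completions is a
    product [\prod_k s k (b k)] of nonzero reals, equal to 1 on the mask.  Its
    sign is governed by a sum over the two-element field and the logarithm of
    its absolute value by a sum over the reals.  Rigidity over the reals comes
    for free: a minor of an integer matrix that is odd is nonzero, so the real
    rank is at least the rank modulo 2, while it is at most [N - d + 1]
    ([additively_rigid_char0]).  Thus the ratio is 1 ([rigid_prod_eq1]). *)

(** * Ranks and row spaces *)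

Lemma submx_colP (F : fieldType) (m1 m2 n : nat)
    (A : 'M[F]_(m1, n)) (B : 'M[F]_(m2, n)) :
  (A <= B)%MS <-> (forall x : 'cV[F]_n, B *m x = 0 -> A *m x = 0).
Proof.
split=> [/submxP[C ->] x Bx0 | kerBA].
  by rewrite -mulmxA Bx0 mulmx0.
rewrite submxE; apply/eqP/matrixP=> i j.
have := kerBA (col j (cokermx B)).
rewrite colE !(mulmxA _ (cokermx B)) mulmx_coker mul0mx => /(_ erefl).
by rewrite -colE => /colP /(_ i); rewrite !mxE.
Qed.

(** A nonzero maximal minor modulo [p] is the reduction of an integer minor,
    which is therefore nonzero, and stays so in characteristic 0. *)
Lemma mxrank_intr_Fp (R : numFieldType) (p m n : nat) (A : 'M[int]_(m, n)) :
  prime p ->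
  (\rank (map_mx intr A : 'M['F_p]_(m, n))
     <= \rank (map_mx intr A : 'M[R]_(m, n)))%N.
Proof.
move=> p_pr; set Ap := map_mx _ A : 'M['F_p]_(m, n).
set AR := map_mx _ A : 'M[R]_(m, n).
(* [f] picks independent rows and [g] then independent columns; they index a
   square submatrix of full rank. *)
have Bfree := maxrowsub_free Ap.
set f := maxrankfun Ap in Bfree; set B := rowsub f Ap in Bfree.
have Btfull : row_full B^T by rewrite /row_full mxrank_tr.
set g := fullrankfun Btfull.
have : rowsub g B^T \in unitmx by exact: fullrowsub_unit.
pose M : 'M[int]__ := mxsub g f A^T.
have -> : rowsub g B^T = map_mx intr M by apply/matrixP=> i j; rewrite !mxE.
rewrite unitmxE det_map_mx unitfE => detM0.
have detMR : \det (map_mx intr M : 'M[R]__) != 0.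
  rewrite det_map_mx intr_eq0; apply: contraNneq detM0 => ->.
  by rewrite rmorph0.
have MRunit : (map_mx intr M : 'M[R]__) \in unitmx by rewrite unitmxE unitfE.
rewrite -(mxrank_unit MRunit) -[X in (_ <= X)%N]mxrank_tr.
have -> : (map_mx intr M : 'M[R]__) = rowsub g 1%:M *m AR^T *m colsub f 1%:M.
  rewrite mul_rowsub_mx mul1mx mulmx_colsub mulmx1.
  by apply/matrixP=> i j; rewrite !mxE.
exact: leq_trans (mxrankM_maxl _ _) (mxrankM_maxr _ _).
Qed.

(** * Rank of the mask matrix and additive rigidity *)

Section MultiIndex.
Variables (d : nat) (n : 'I_d -> nat).

Definition coord_set (g : multi_index n) (k : 'I_d) (j : 'I_(n k)) :
  multi_index n := [ffun l => dfwith g j l].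

Lemma coord_set_in g k j : @coord_set g k j k = j.
Proof. by rewrite ffunE dfwith_in. Qed.

Lemma coord_set_out g k j l : k != l -> @coord_set g k j l = g l.
Proof. by move=> kl; rewrite ffunE dfwith_out. Qed.

(** This says that the observed rows [index_row F a] span all index rows
    ([additively_rigidP]), in a form that applies directly to signs and to
    logarithms of the factors of a rank-one tensor. *)
Definition additively_rigid (F : fieldType) (A : {set multi_index n}) : Prop :=
  forall X : forall k, 'I_(n k) -> F,
    (forall a, a \in A -> \sum_k X k (a k) = 0) ->
    forall b : multi_index n, \sum_k X k (b k) = 0.

(** Over ['F_2] these are convertible to [index_vector] and, below, to
    [mask_matrix]; a general base ring allows one 0-1 matrix to be compared
    over the integers, ['F_2] and the reals. *)
Definition index_row (F : pzRingType) (a : multi_index n) :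
    'rV[F]_(\sum_k n k) := \mxrow_k delta_mx 0 (a k).

Definition index_mx (F : pzRingType) (A : {set multi_index n}) :
    'M[F]_(#|A|, \sum_k n k) := \matrix_(r < #|A|) index_row F (enum_val r).

Lemma map_index_mx (F : pzRingType) A :
  map_mx intr (index_mx int A) = index_mx F A.
Proof. by apply/matrixP=> i j; rewrite !mxE; case: (_ && _). Qed.

Section Field.
Variable F : fieldType.
Implicit Types (A : {set multi_index n}) (x : 'cV[F]_(\sum_k n k)).

Definition block_entry x k (j : 'I_(n k)) : F := submxcol x k j 0.

Definition block_col (X : forall k, 'I_(n k) -> F) : 'cV[F]_(\sum_k n k) :=
  \mxcol_k \col_j X k j.

Lemma block_colK X k j : block_entry (block_col X) j = X k j.
Proof. by rewrite /block_entry mxcolK mxE. Qed.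

Lemma index_row_mul a x : (index_row F a *m x) 0 0 = \sum_k block_entry x (a k).
Proof.
rewrite -[in LHS](submxcolK x) mul_mxrow_mxcol summxE.
by apply: eq_bigr => k _; rewrite -rowE mxE.
Qed.

Lemma index_mx_ker A x :
  index_mx F A *m x = 0 <->
  (forall a, a \in A -> \sum_k block_entry x (a k) = 0).
Proof.
split=> [Ax0 a aA | sum0].
  rewrite -index_row_mul; move/row_matrixP/(_ (enum_rank_in aA a)): Ax0.
  by rewrite row_mul rowK enum_rankK_in // row0 => ->; rewrite mxE.
apply/row_matrixP=> r; rewrite row_mul rowK row0.
apply/matrixP=> i j; rewrite !ord1 index_row_mul mxE.
exact/sum0/enum_valP.
Qed.

Lemma additively_rigidP A :
  additively_rigid F A <-> (index_mx F [set: multi_index n] <= index_mx F A)%MS.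
Proof.
split=> [rigA | /submx_colP sub X XA b].
  apply/submx_colP=> x /index_mx_ker xA; apply/index_mx_ker => b _.
  exact: rigA (block_entry x) xA b.
have /index_mx_ker/(_ b (in_setT b)) : index_mx F setT *m block_col X = 0.
  apply/sub/index_mx_ker => a aA; rewrite -[RHS](XA a aA).
  by apply: eq_bigr => k _; rewrite block_colK.
by move=> sum0; rewrite -[RHS]sum0; apply: eq_bigr => k _; rewrite block_colK.
Qed.

Lemma index_mx_subT A : (index_mx F A <= index_mx F [set: multi_index n])%MS.
Proof.
apply/submx_colP=> x /index_mx_ker xT; apply/index_mx_ker=> a _.
exact/xT/in_setT.
Qed.

Lemma index_row_sub A a : a \in A -> (index_row F a <= index_mx F A)%MS.
Proof.
move=> aA; apply/submx_colP=> x /index_mx_ker/(_ a aA) sum0.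
by apply/matrixP=> i j; rewrite !ord1 index_row_mul sum0 mxE.
Qed.

(** Right multiplication by this matrix sends a row to its [d] block sums. *)
Definition block_sum_mx : 'M[F]_(\sum_k n k, d) :=
  \mxcol_l \matrix_(j, k) (l == k)%:R.

(** The unit rows at the base point [g], one per block.  Adjoining them to the
    index rows fixes the freedom to add to the [X k] constants of total sum
    zero, which no index row detects. *)
Definition gauge_mx (g : multi_index n) : 'M[F]_(d, \sum_k n k) :=
  \mxrow_l delta_mx l (g l).

Lemma index_row_block_sum a : index_row F a *m block_sum_mx = const_mx 1.
Proof.
rewrite mul_mxrow_mxcol; apply/rowP=> k; rewrite summxE mxE (bigD1 k) //=.
rewrite -rowE !mxE eqxx big1 ?addr0 // => l lk.
by rewrite -rowE !mxE (negPf lk).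
Qed.

Lemma index_mx_block_sum A : index_mx F A *m block_sum_mx = const_mx 1.
Proof.
apply/row_matrixP=> r; rewrite row_mul rowK index_row_block_sum.
by apply/rowP=> k; rewrite !mxE.
Qed.

Lemma gauge_mx_mul g m (B : forall l, 'M[F]_(n l, m)) i j :
  (gauge_mx g *m \mxcol_l B l) i j = B i (g i) j.
Proof.
rewrite mul_mxrow_mxcol summxE (bigD1 i) //= mxE (bigD1 (g i)) //=.
rewrite mxE !eqxx mul1r big1 ?addr0 => [|r rg]; last first.
  by rewrite mxE (negPf rg) andbF mul0r.
rewrite big1 ?addr0 // => l li; rewrite mxE big1 // => r _.
by rewrite mxE eq_sym (negPf li) mul0r.
Qed.

Lemma gauge_mx_block_sum g : gauge_mx g *m block_sum_mx = 1%:M.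
Proof. by apply/matrixP=> i k; rewrite gauge_mx_mul !mxE. Qed.

Lemma const_mul_gauge g : const_mx 1 *m gauge_mx g = index_row F g.
Proof.
rewrite mul_mxrow; apply/eq_mxrow=> l; apply/rowP=> j.
rewrite !mxE (bigD1 l) //= big1 ?addr0 ?mxE ?mul1r ?eqxx // => i il.
by rewrite !mxE (negPf il) mulr0.
Qed.

(** A column killed by the gauge rows has zero entries at the base point, and
    the base point with one coordinate moved to [j] then isolates the entry
    at [j]. *)
Lemma index_mx_gauge_full g :
  row_full (index_mx F [set: multi_index n] + gauge_mx g)%MS.
Proof.
rewrite -sub1mx addsmxE; apply/submx_colP=> x; rewrite mul1mx mul_col_mx.
rewrite -[0]vsubmxK => /eq_col_mx[]; rewrite !linear0.
move=> /index_mx_ker xT gx0.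
have gauge0 l : block_entry x (g l) = 0.
  by rewrite /block_entry -(gauge_mx_mul g (submxcol x)) submxcolK gx0 mxE.
rewrite -[x]submxcolK -[RHS]submxcolK; apply/eq_mxcol=> k.
apply/colP=> j; rewrite submxcol0 [RHS]mxE.
have := xT (coord_set g j) (in_setT _).
rewrite (bigD1 k) //= coord_set_in big1 ?addr0 // => l lk.
by rewrite coord_set_out ?gauge0 // eq_sym.
Qed.

(** All block sums of a combination of index rows are equal, while the block
    sums of a combination of gauge rows are its coefficients.  A common vector
    is thus a multiple of the sum of the gauge rows, which is the index row
    of [g]. *)
Lemma index_mx_cap_gauge g :
  (index_mx F [set: multi_index n] :&: gauge_mx g :=: index_row F g)%MS.
Proof.
apply/eqmxP/andP; split; last first.
  by rewrite sub_capmx index_row_sub ?in_setT // -const_mul_gauge submxMl.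
apply/row_subP=> i; set w := row i _.
have : (w <= index_mx F [set: multi_index n] :&: gauge_mx g)%MS.
  exact: row_sub.
rewrite sub_capmx => /andP[/submxP[c cE] /submxP[e eE]].
have eC : e = c *m const_mx 1.
  rewrite -(index_mx_block_sum setT) mulmxA -cE eE -mulmxA.
  by rewrite gauge_mx_block_sum mulmx1.
have -> : w = (\sum_r c 0 r) *: index_row F g.
  rewrite eE -const_mul_gauge scalemxAl; congr (_ *m _); rewrite eC.
  apply/rowP=> k; rewrite !mxE mulr1; apply: eq_bigr => r _.
  by rewrite mxE mulr1.
exact: scalemx_sub.
Qed.

Lemma rank_index_mxT (g : multi_index n) :
  (0 < d)%N ->
  \rank (index_mx F [set: multi_index n]) = (\sum_k n k - d + 1)%N.
Proof.
move=> d_gt0.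
have := mxrank_sum_cap (index_mx F [set: multi_index n]) (gauge_mx g).
rewrite index_mx_cap_gauge (eqP (index_mx_gauge_full g)).
have -> : \rank (gauge_mx g) = d.
  apply/eqP; rewrite -/(row_free _); apply/row_freeP.
  by exists block_sum_mx; exact: gauge_mx_block_sum.
have -> : \rank (index_row F g) = 1%N.
  rewrite rank_rV; case: eqP => // row0.
  have /rowP/(_ (Ordinal d_gt0)) := index_row_block_sum g.
  by rewrite row0 mul0mx !mxE => /esym/eqP; rewrite oner_eq0.
have le_dn : (d <= \sum_k n k)%N.
  rewrite -[leqLHS]card_ord -sum1_card leq_sum // => k _.
  exact: leq_ltn_trans (ltn_ord (g k)).
by move=> eq_rank; apply/(@addIn d); rewrite -eq_rank addnAC subnK.
Qed.

Lemma rank_index_mxP (g : multi_index n) A :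
  (0 < d)%N ->
  \rank (index_mx F A) = (\sum_k n k - d + 1)%N <-> additively_rigid F A.
Proof.
move=> d_gt0; rewrite -(rank_index_mxT g d_gt0) additively_rigidP.
have [_ <-] := mxrank_leqif_sup (index_mx_subT A).
by split=> [->|/eqP].
Qed.

End Field.

(** The real rank of the mask matrix lies between its rank modulo 2 and
    [\sum_k n k - d + 1].  The converse fails: with [d = 3] and all [n k = 2], the mask
    of the multi-indices 000, 011, 101, 110 has real rank 4 but rank 3 modulo
    2. *)
Lemma additively_rigid_char0 (R : numFieldType) (g : multi_index n) A :
  (0 < d)%N -> additively_rigid 'F_2 A -> additively_rigid R A.
Proof.
move=> d_gt0 /(rank_index_mxP _ g _ d_gt0) rk2.
apply/(rank_index_mxP _ g _ d_gt0).
apply/eqP; rewrite eqn_leq -{1}(rank_index_mxT R g d_gt0).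
rewrite mxrankS ?index_mx_subT //= -rk2 -(map_index_mx R) -(map_index_mx 'F_2).
exact: mxrank_intr_Fp.
Qed.

(** Otherwise the indicator of the missed coordinate has zero sums on the
    mask but not at a multi-index through that coordinate. *)
Lemma additively_rigid_cover (F : fieldType) (g : multi_index n) A k
    (j : 'I_(n k)) :
  additively_rigid F A -> exists2 a, a \in A & a k = j.
Proof.
move=> rigA; case: (pselect (exists2 a, a \in A & a k = j)) => // nocov.
(* Coordinates of different blocks have different types, so the indicator
   compares dependent pairs. *)
pose X l (i : 'I_(n l)) : F := (Tagged (fun l => 'I_(n l)) i == Tagged _ j)%:R.
have X0 l i : k != l -> X l i = 0.
  by move=> kl; rewrite /X -tag_eqE /tag_eq /= eq_sym (negPf kl).
have Xsum a : \sum_l X l (a l) = (a k == j)%:R.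
  rewrite (bigD1 k) //= big1 ?addr0 => [|l lk]; last by rewrite X0 // eq_sym.
  by rewrite /X eq_Tagged.
have /eqP : \sum_l X l (coord_set g j l) = 0.
  apply: rigA => a aA; rewrite Xsum; case: eqP => // ajk.
  by case: nocov; exists a.
by rewrite Xsum coord_set_in eqxx oner_eq0.
Qed.

(** * Signs, absolute values and unique recovery *)

Variable R : realType.

(** Rigidity turns from additive to multiplicative through the isomorphism of
    the nonzero reals with the product of a two-element group of signs and the
    additive reals. *)
Lemma rigid_prod_eq1 (g : multi_index n) A (s : forall k, 'I_(n k) -> R) :
    (0 < d)%N -> additively_rigid 'F_2 A -> (forall k j, s k j != 0) ->
    (forall a, a \in A -> \prod_k s k (a k) = 1) ->
  forall b : multi_index n, \prod_k s k (b k) = 1.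
Proof.
move=> d_gt0 rig2 s0 sA b.
pose y k (j : 'I_(n k)) : bool := s k j < 0.
have pabs (a : multi_index n) : 0 < \prod_k `|s k (a k)|.
  by rewrite prodr_gt0 // => k _; rewrite normr_gt0.
have lnprod (a : multi_index n) :
    ln (\prod_k `|s k (a k)|) = \sum_k ln `|s k (a k)|.
  apply: expR_inj; rewrite lnK ?posrE // expR_sum; apply: eq_bigr => k _.
  by rewrite lnK // posrE normr_gt0.
have abs1 : \prod_k `|s k (b k)| = 1.
  apply: ln_inj; rewrite ?posrE // ln1 lnprod.
  apply: (additively_rigid_char0 (R := R) g d_gt0 rig2
    (X := fun k j => ln `|s k j|)).
  by move=> a aA; rewrite -lnprod -normr_prod sA // normr1 ln1.
have split_sign (a : multi_index n) : \prod_k s k (a k) =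
    (-1) ^+ (\sum_k y k (a k))%N * \prod_k `|s k (a k)|.
  rewrite expr_sum -big_split /=; apply: eq_bigr => k _.
  by rewrite -numEsign ?num_real.
have oddF2 m : (m%:R == 0 :> 'F_2) = ~~ odd m.
  by rewrite -(dvdn_pcharf (pchar_Fp (isT : prime 2))) dvdn2.
have even_y : ~~ odd (\sum_k y k (b k)).
  rewrite -oddF2 natr_sum.
  apply/eqP/(rig2 (fun k j => (y k j)%:R)) => a aA.
  apply/eqP; rewrite -natr_sum oddF2; apply/negP => odd_y.
  have := sA a aA; rewrite split_sign -signr_odd odd_y expr1 mulN1r => eq1.
  by have := pabs a; rewrite -oppr_lt0 eq1 ltNge ler01.
by rewrite split_sign abs1 mulr1 -signr_odd (negPf even_y).
Qed.

Lemma rigid_unique_recovery (g : multi_index n) A :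
  (0 < d)%N -> additively_rigid 'F_2 A -> unique_recovery R A.
Proof.
move=> d_gt0 rig2 That That0.
case: (pselect (exists T : tensor R n, exact_completion That T)); last by left.
move=> [T [[T0 [u Tu]] TA]]; right; exists T; split.
  by split=> //; split=> //; exists u.
move=> T' [[T'0 [v Tv]] T'A].
have neq0 (w : forall k, 'rV[R]_(n k)) :
    (forall a : {a | a \in A}, \prod_k w k 0 (val a k) = That a) ->
  forall k j, w k 0 j != 0.
  move=> wA k j; have [a aA akj] := additively_rigid_cover g j rig2.
  have := That0 (exist _ a aA); rewrite -wA /= => /eqP/prodf_neq0/(_ k isT).
  by rewrite akj.
have u0 : forall k j, u k 0 j != 0 by apply: neq0 => a; rewrite -Tu.
have v0 : forall k j, v k 0 j != 0 by apply: neq0 => a; rewrite -Tv.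
have ratio (b : multi_index n) :
    \prod_k (u k 0 (b k) / v k 0 (b k)) = T b / T' b.
  by rewrite Tu Tv prodf_div.
apply/ffunP=> b.
have T'b0 : T' b != 0 by rewrite Tv; apply/prodf_neq0 => k _; exact: v0.
apply: (divIf T'b0); rewrite divff // -ratio.
apply: (rigid_prod_eq1 (s := fun k j => u k 0 j / v k 0 j) g d_gt0 rig2).
  by move=> k j; rewrite mulf_neq0 ?invr_eq0.
move=> a aA; rewrite ratio (TA (exist _ a aA)) (T'A (exist _ a aA)).
by rewrite divff //; apply/eqP.
Qed.

(** Two completions of the all-ones data are the constant tensor 1 and the sign
    tensor of any family with zero sums on the mask. *)
Lemma unique_recovery_rigid A : unique_recovery R A -> additively_rigid 'F_2 A.
Proof.
move=> recA X XA b.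
pose signs (a : multi_index n) : R := \prod_k (-1) ^+ (X k (a k) : nat).
have signsE a : signs a = (-1) ^+ (\sum_k X k (a k) != 0).
  rewrite /signs -expr_sum -signr_odd; congr (_ ^+ (nat_of_bool _)).
  have -> : \sum_k X k (a k) = (\sum_k (X k (a k) : nat))%:R.
    by rewrite natr_sum; apply: eq_bigr => k _; rewrite natr_Zp.
  by rewrite -(dvdn_pcharf (pchar_Fp (isT : prime 2))) dvdn2 negbK.
pose T1 : tensor R n := [ffun=> 1].
pose T2 : tensor R n := [ffun a => signs a].
pose That : {ffun {a | a \in A} -> R} := [ffun=> 1].
have T1sol : exact_completion That T1.
  split; last by move=> a; rewrite !ffunE.
  split; first by move/ffunP/(_ b)/eqP; rewrite !ffunE oner_eq0.
  exists (fun k => const_mx 1) => a; rewrite ffunE big1 // => k _.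
  by rewrite mxE.
have T2sol : exact_completion That T2.
  split; last by move=> [a aA]; rewrite !ffunE signsE XA // eqxx.
  split; first by move/ffunP/(_ b)/eqP; rewrite !ffunE signsE signr_eq0.
  exists (fun k => \row_j (-1) ^+ (X k j : nat)) => a; rewrite ffunE.
  by apply: eq_bigr => k _; rewrite mxE.
have That0 a : That a <> 0 by rewrite ffunE; apply/eqP/oner_neq0.
case: (recA That That0) => [[]|[T [_ Tuniq]]]; first by exists T1.
have /ffunP/(_ b) : T1 = T2 by rewrite -(Tuniq _ T1sol) -(Tuniq _ T2sol).
rewrite !ffunE signsE; case: eqP => // _ /eqP.
by rewrite eq_sym eqNr oner_eq0.
Qed.

End MultiIndex.

Theorem proposition1 (R : realType) (d : nat) (n : 'I_d -> nat)
    (d_gt0 : (0 < d)%N) (n_gt0 : forall k : 'I_d, (0 < n k)%N)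
    (Omega : {set multi_index n}) :
  unique_recovery R Omega <->
  \rank (mask_matrix Omega) = ((\sum_(k < d) n k) - d + 1)%N.
Proof.
pose g : multi_index n := [ffun k => Ordinal (n_gt0 k)].
rewrite (rank_index_mxP 'F_2 g Omega d_gt0); split.
  exact: unique_recovery_rigid.
exact: rigid_unique_recovery.
Qed.
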